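(* Let $a,b\in\mathbb{R}$ with $a\neq 0$ and $b\neq 0$, and let $W$ be the $2\times 2$ weight matrix on $\mathbb{R}$ $$W(x)=e^{-x^{2}}\begin{pmatrix} e^{2bx}+a^{2}x^{2} & ax\\ ax & 1\end{pmatrix},\qquad x\in\mathbb{R}.$$ Then $W$ is not a noncommutative bispectral Darboux transformation of any direct sum of classical scalar weights.
   Context: A weight matrix of size $N$ is a complex $N\times N$ matrix-valued integrable function on an interval $(x_0,x_1)$ (possibly unbounded) that is positive definite almost everywhere and has finite moments of all orders. It defines the sesquilinear form $\langle P,Q\rangle_W=\int_{x_0}^{x_1}P(x)W(x)Q(x)^*\,dx$ on $\operatorname{Mat}_N(\mathbb{C}[x])$. There is a unique sequence $P(x,n)$, $n\in\mathbb{N}_0$, of monic orthogonal polynomials: $P(x,n)$ is a matrix polynomial of degree $n$ with leading coefficient $I$, and $\langle P(\cdot,n),P(\cdot,m)\rangle_W=0$ for $n\ne m$. The classical scalar weights are, up to an affine change of the coordinate $x$ (and positive scalar multiples), the Hermite weight $e^{-x^2}$ on $\mathbb{R}$, the Laguerre weights $e^{-x}x^{\alpha}$ on $(0,\infty)$ ($\alpha>-1$), and the Jacobi weights $(1-x)^{\alpha}(1+x)^{\beta}$ on $(-1,1)$ ($\alpha,\beta>-1$). A direct sum of classical scalar weights (here of size 2) is a diagonal weight matrix whose diagonal entries are classical scalar weights. Differential operators $\mathfrak D=\sum_{j=0}^s\partial^jF_j(x)$, $\partial=\frac{d}{dx}$, act on the right on matrix-valued functions: $P\cdot\mathfrak D=\sum_j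 P^{(j)}(x)F_j(x)$. $\operatorname{Mat}_N(\Omega[x])$ denotes the algebra of those with $F_j\in\operatorname{Mat}_N(\mathbb{C}[x])$. Products are compositions of right actions: $P\cdot(\mathfrak D_1\mathfrak D_2)=(P\cdot\mathfrak D_1)\cdot\mathfrak D_2$, and a matrix- or scalar-valued function acts by right multiplication. Discrete operators $\mathscr M=\sum_{j=-\ell}^kA_j(n)\delta^j$, with $A_j(n)\in\operatorname{Mat}_N(\mathbb{C})$ for each $n$, act on the left by $(\mathscr M\cdot P)(x,n)=\sum_{j=-\ell}^kA_j(n)P(x,n+j)$, with $P(x,m)=0$ for $m<0$. The right Fourier algebra of a weight matrix $V$ with monic orthogonal polynomials $P(x,n)$ is $$\mathcal F_R(V)=\{\mathfrak D\in\operatorname{Mat}_N(\Omega[x]):\ \exists\text{ a discrete operator }\mathscr M\text{ with }P(x,n)\cdot\mathfrak D=\mathscr M\cdot P(x,n)\ \text{for all } n\}.$$ Let $V(x)$ and $\widetilde V(x)$ be weight matrices of size $N$ with sequences of monic orthogonal polynomials $P(x,n)$ and $\widetilde P(x,n)$. One says that $\widetilde V$ is a noncommutative bispectral Darboux transformation of $V$ if there exist differential operators $\mathfrak D,\widetilde{\mathfrak D}\in\mathcal F_R(V)$, (nonzero) polynomials $F(x),\widetilde F(x)\in\mathbb{C}[x]$, and sequences of matrices $C(n),\widetilde C(n)\in\operatorname{Mat}_N(\mathbb{C})$, nonsingular for almost every $n$ (all but finitely many $n$), such that $$C(n)\widetilde P(x,n)=P(x,n)\cdot\mathfrak D F(x)^{-1}\quad\text{and}\quad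 \widetilde C(n)P(x,n)=\widetilde P(x,n)\cdot\widetilde F(x)^{-1}\widetilde{\mathfrak D}.$$ *)

(* Defs.v *)
From HB Require Import structures.
From mathcomp Require Import all_boot all_order all_algebra.
From mathcomp Require Import generic_quotient fraction spectral complex.
From mathcomp Require Import all_classical all_reals all_analysis.
From mathcomp Require Import measurable_realfun ring.

Set Implicit Arguments.
Unset Strict Implicit.
Unset Printing Implicit Defensive.

Import Order.TTheory GRing.Theory Num.Theory.
Import numFieldNormedType.Exports.

Local Open Scope classical_set_scope.
Local Open Scope ring_scope.
Local Open Scope sesquilinear_scope.
Local Open Scope complex_scope.

Section WeightMatrices.
Variable R : realType.
Local Notation C := R[i].
Local Notation mu := (@lebesgue_measure R).

Definition open_interval (x0 x1 : \bar R) : set R :=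
  [set x | (x0 < x%:E < x1)%E].

Lemma open_interval_setT : open_interval -oo +oo = setT.
Proof.
by apply/seteqP; split => x //= _; apply/andP; split;
  [exact: ltNyr|exact: ltry].
Qed.

Definition cintegrable (I : set R) (f : R -> C) : Prop :=
  mu.-integrable I (fun x => (complex.Re (f x))%:E) /\
  mu.-integrable I (fun x => (complex.Im (f x))%:E).

Definition cintegral (I : set R) (f : R -> C) : C :=
  (\int[mu]_(x in I) complex.Re (f x)) +i* (\int[mu]_(x in I) complex.Im (f x)).

(* In R[i], 0 < z means that z is real and positive. *)
Definition posdefmx (N : nat) (A : 'M[C]_N) : Prop :=
  A ^t* = A /\ forall u : 'rV[C]_N, u != 0 -> 0 < (u *m A *m u ^t*) 0 0.

(* Only the values of wm_fun on ]x0, x1[ are meaningful.  The moment of order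
   k = 0 in wm_moments is the integrability of the weight itself. *)
Record weight_matrix (N : nat) := WeightMatrix {
  wm_x0 : \bar R;
  wm_x1 : \bar R;
  wm_fun :> R -> 'M[C]_N;
  wm_lt : (wm_x0 < wm_x1)%E;
  wm_posdef :
    {ae mu, forall x, open_interval wm_x0 wm_x1 x -> posdefmx (wm_fun x)};
  wm_moments : forall (k : nat) (i j : 'I_N),
    cintegrable (open_interval wm_x0 wm_x1)
      (fun x => (x ^+ k)%:C * wm_fun x i j)
}.

Definition wm_supp (N : nat) (V : weight_matrix N) : set R :=
  open_interval (wm_x0 V) (wm_x1 V).

Definition mxpoly_eval (N : nat) (P : 'M[{poly C}]_N) (x : R) : 'M[C]_N :=
  map_mx (fun p : {poly C} => p.[x%:C]) P.

Definition wm_form (N : nat) (V : weight_matrix N) (P Q : 'M[{poly C}]_N) :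
    'M[C]_N :=
  \matrix_(i, j) cintegral (wm_supp V)
    (fun x => (mxpoly_eval P x *m V x *m (mxpoly_eval Q x) ^t*) i j).

Definition mxpoly_monic (N n : nat) (P : 'M[{poly C}]_N) : Prop :=
  forall i j, (size ((P - ('X^n)%:M)%R i j) <= n)%N.

Definition monic_orthogonal (N : nat) (V : weight_matrix N)
    (P : nat -> 'M[{poly C}]_N) : Prop :=
  (forall n, mxpoly_monic n (P n)) /\
  (forall n m, n != m -> wm_form V (P n) (P m) = 0).

End WeightMatrices.

Section ClassicalWeights.
Variable R : realType.

Variant canonical_weight : set R -> (R -> R) -> Prop :=
| Hermite : canonical_weight setT (fun x => expR (- x ^+ 2))
| Laguerre (alpha : R) of -1 < alpha :
    canonical_weight `]0, +oo[ (fun x => expR (- x) * x `^ alpha)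
| Jacobi (alpha beta : R) of -1 < alpha & -1 < beta :
    canonical_weight `]-1, 1[ (fun x => (1 - x) `^ alpha * (1 + x) `^ beta).

(* w is a classical scalar weight with interval of definition I. *)
Definition classical_weight (I : set R) (w : R -> R) : Prop :=
  exists (I0 : set R) (w0 : R -> R) (c s t : R),
    [/\ canonical_weight I0 w0, 0 < c, s != 0,
        I = [set x | I0 (s * x + t)]
      & forall x, I x -> w x = c * w0 (s * x + t)].

(* A weight matrix is positive definite almost everywhere on its interval, so
   all diagonal entries live on that same interval. *)
Definition direct_sum_classical (N : nat) (V : weight_matrix R N) : Prop :=
  exists w : 'I_N -> R -> R,
    (forall i, classical_weight (wm_supp V) (w i)) /\
    (forall x, wm_supp V x -> V x = diag_mx (\row_i (w i x)%:C)).

End ClassicalWeights.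

(* Operators may contain multiplication by the inverse of a polynomial, hence
   act on matrices of rational functions. *)
Section RationalFunctions.
Variable F : fieldType.
Local Notation "p %:F" := (tofrac p) : ring_scope.

Definition frac_deriv (f : {fraction {poly F}}) : {fraction {poly F}} :=
  let: (p, q) := frac (generic_quotient.repr f) in
  (p^`() * q - p * q^`())%:F / (q ^+ 2)%:F.

Lemma frac_repr (f : {fraction {poly F}}) :
  f * ((frac (generic_quotient.repr f)).2)%:F
  = ((frac (generic_quotient.repr f)).1)%:F.
Proof.
rewrite -{1}[f]reprK; set r := generic_quotient.repr f.
rewrite ![_%:F]piE -[_ * _]/(FracField.mul _ _) -FracField.pi_mul.
apply/eqP; rewrite piE; apply/eqP => /=.
rewrite /FracField.mulf !numden_Ratio ?mulr1 ?mulf_neq0 ?oner_neq0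
  ?denom_ratioP //.
by rewrite mulrC.
Qed.

Lemma frac_derivE (p q : {poly F}) : q != 0 ->
  frac_deriv (p%:F / q%:F) = (p^`() * q - p * q^`())%:F / (q ^+ 2)%:F.
Proof.
move=> q0; have := frac_repr (p%:F / q%:F).
rewrite /frac_deriv; set r := generic_quotient.repr _.
have d0 : (frac r).2 != 0 by exact: denom_ratioP.
case: (frac r) d0 => n d /= d0 H.
have E : p * d = n * q.
  apply/eqP; rewrite -tofrac_eq !tofracM -H mulrAC divfK ?tofrac_eq0 //.
have E' : p^`() * d + p * d^`() = n^`() * q + n * q^`() by rewrite -!derivM E.
apply/eqP; rewrite eqr_div ?tofrac_eq0 ?expf_neq0 // -!tofracM tofrac_eq.
apply/eqP.
have -> : (n^`() * d - n * d^`()) * q ^+ 2 =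
  d * q * (n^`() * q) - (n * q) * q * d^`() by ring.
have -> : n^`() * q = p^`() * d + p * d^`() - n * q^`() by rewrite E' addrK.
rewrite -E.
have -> : d * q * (p^`() * d + p * d^`() - n * q^`()) - p * d * q * d^`() =
  d * q * p^`() * d - d * q^`() * (n * q) by ring.
rewrite -E; ring.
Qed.

Lemma frac_deriv_tofrac (p : {poly F}) : frac_deriv p%:F = (p^`())%:F.
Proof.
have := @frac_derivE p 1 (oner_neq0 _).
rewrite tofrac1 divr1 => ->.
by rewrite derivC mulr1 mulr0 subr0 expr1n tofrac1 divr1.
Qed.

End RationalFunctions.

Section Operators.
Variables (F : fieldType) (N : nat).
Local Notation K := {fraction {poly F}}.

Definition mxfrac (P : 'M[{poly F}]_N) : 'M[K]_N := map_mx (@tofrac _) P.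

(* The sequence [:: F_0; ...; F_s] stands for \sum_j \partial^j F_j(x), acting
   on the right. *)
Definition diffop := seq 'M[{poly F}]_N.

Definition diffop_act (Q : 'M[K]_N) (D : diffop) : 'M[K]_N :=
  \sum_(j < size D) map_mx (iter j (@frac_deriv F)) Q *m mxfrac (nth 0 D j).

(* \sum_(- l <= j <= k) A_j(n) \delta^j, with P(x, m) = 0 for m < 0. *)
Definition discr_act (l k : nat) (A : int -> nat -> 'M[F]_N)
    (P : nat -> 'M[{poly F}]_N) (n : nat) : 'M[{poly F}]_N :=
  let Pext (m : int) := if m is Posz m' then P m' else 0 in
  \sum_(i < (l + k).+1)
    let j : int := i%:Z - l%:Z in map_mx polyC (A j n) *m Pext (n%:Z + j).

(* The right Fourier algebra of a weight matrix with monic orthogonal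
   polynomials P. *)
Definition right_fourier (P : nat -> 'M[{poly F}]_N) (D : diffop) : Prop :=
  exists (l k : nat) (A : int -> nat -> 'M[F]_N), forall n,
    diffop_act (mxfrac (P n)) D = mxfrac (discr_act l k A P n).

End Operators.

Section Darboux.
Variables (R : realType) (N : nat).
Local Notation C := R[i].

(* Vt is a noncommutative bispectral Darboux transformation of V.  The
   sequences P and Pt are unique. *)
Definition bispectral_darboux (V Vt : weight_matrix R N) : Prop :=
  exists P Pt : nat -> 'M[{poly C}]_N,
  [/\ monic_orthogonal V P, monic_orthogonal Vt Pt &
  exists (D Dt : diffop C N) (f ft : {poly C}) (c ct : nat -> 'M[C]_N),
  [/\ right_fourier P D /\ right_fourier P Dt,
      f != 0 /\ ft != 0,
      exists n0, forall n, (n0 <= n)%N -> c n \in unitmx /\ ct n \in unitmx,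
      forall n, mxfrac (map_mx polyC (c n) *m Pt n) =
        (tofrac f)^-1 *: diffop_act (mxfrac (P n)) D
    & forall n, mxfrac (map_mx polyC (ct n) *m P n) =
        diffop_act ((tofrac ft)^-1 *: mxfrac (Pt n)) Dt]].

End Darboux.

Section GaussianMoments.
Variable R : realType.
Local Notation mu := (@lebesgue_measure R).

Lemma integrable_gauss_shift (c : R) :
  mu.-integrable setT (fun x => (expR (- x ^+ 2 + c * x))%:E).
Proof.
pose s : R := Num.sqrt 2^-1.
have s0 : s != 0 by rewrite gt_eqF // sqrtr_gt0 invr_gt0.
have s2 : s ^+ 2 *+ 2 = 1 by rewrite sqr_sqrtr ?invr_ge0 // -mulr_natr mulVf.
have H := @integrableZl _ _ R mu _ measurableT
  ((normal_peak s)^-1 * expR (c ^+ 2 / 4)) _ (integrable_normal_pdf (c / 2) s).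
apply: eq_integrable H => // x _; rewrite normal_pdfE //.
rewrite /normal_fun s2 divr1 -EFinM mulrACA mulVf ?gt_eqF ?normal_peak_gt0 //.
rewrite mul1r -expRD; congr (expR _)%:E; by field.
Qed.

Lemma expr_le_expR (k : nat) (x : R) :
  `|x ^+ k| <= k`!%:R * (expR x + expR (- x)).
Proof.
have H (y : R) : 0 <= y -> y ^+ k <= k`!%:R * expR y.
  move=> y0; case: k => [|k]; first
    by rewrite expr0 fact0 mul1r (le_trans _ (expR_ge1Dx y)) // lerDl.
  have := expR_ge1Dxn k y0.
  rewrite -ler_pdivrMl ?ltr0n ?fact_gt0 // mulrC; apply: le_trans.
  by rewrite lerDr.
rewrite normrX; have [x0|x0] := leP 0 x.
  rewrite ger0_norm // (le_trans (H _ x0)) // ler_wpM2l // lerDl expR_ge0 //.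
have x1 : 0 <= - x by rewrite oppr_ge0 ltW.
rewrite ltr0_norm // (le_trans (H _ x1)) // ler_wpM2l // lerDr expR_ge0 //.
Qed.

Lemma integrable_gauss_moment (c : R) (k : nat) :
  mu.-integrable setT (fun x => (x ^+ k * expR (- x ^+ 2 + c * x))%:E).
Proof.
have H := @integrableZl _ _ R mu _ measurableT (k`!%:R) _
  (integrableD measurableT (integrable_gauss_shift (c + 1))
    (integrable_gauss_shift (c - 1))).
apply: le_integrable H => //.
  apply/measurable_EFinP; apply: measurable_funM; first exact: measurable_funX.
  apply: measurableT_comp => //; apply: measurable_funD.
    by apply: measurableT_comp => //; exact: measurable_funX.
  exact: measurable_funM.
move=> x _ /=; rewrite lee_fin normrM [X in _ * X <= _]ger0_norm ?expR_ge0 //.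
rewrite [leRHS]ger0_norm; last by rewrite mulr_ge0 // addr_ge0 ?expR_ge0.
rewrite (_ : expR (_ + (c + 1) * x) = expR (- x ^+ 2 + c * x) * expR x);
  last first.
  by rewrite -expRD; congr expR; ring.
rewrite (_ : expR (_ + (c - 1) * x) = expR (- x ^+ 2 + c * x) * expR (- x));
  last first.
  by rewrite -expRD; congr expR; ring.
rewrite -mulrDr mulrCA mulrC; apply: ler_wpM2l; first exact: expR_ge0.
exact: expr_le_expR.
Qed.
End GaussianMoments.

Section TheWeight.
Variables (R : realType) (a b : R).
Local Notation mu := (@lebesgue_measure R).

Definition Wfun (x : R) : 'M[R[i]]_2 :=
  map_mx (real_complex R) (expR (- x ^+ 2) *:
    \matrix_(i < 2, j < 2)
      nth 0 (nth [::] [:: [:: expR (2 * b * x) + a ^+ 2 * x ^+ 2; a * x];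
                          [:: a * x;                              1    ]] i) j).

Lemma Wfun_posdef x : posdefmx (Wfun x).
Proof.
split.
  apply/matrixP => i j; rewrite !mxE.
  have -> : forall y : R, (y%:C)^*%R = y%:C by move=> y; exact: conjc_real.
  congr (_ * _)%:C.
  by case: i j => [[|[|//]] ?] [[|[|//]] ?].
move=> u u0.
pose y := u 0 0; pose z := u 0 1.
have -> : (u *m Wfun x *m u ^t*) 0 0 = (expR (- x ^+ 2))%:C *
   ((expR (2 * b * x))%:C * (`|y| ^+ 2) + `|(a * x)%:C * y + z| ^+ 2).
  have cD : (((a * x)%:C * y + z)^*)%R = ((a * x)%:C * y^* + z^*)%R.
    by rewrite rmorphD rmorphM /=; congr (_ * _ + _); exact: conjc_real.
  rewrite !normCK cD.
  rewrite !mxE !big_ord_recr !big_ord0 /= !mxE !big_ord_recr !big_ord0 /= !mxE /=.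
  rewrite (_ : widen_ord _ _ = 0); last exact/val_inj.
  rewrite (_ : ord_max = 1); last exact/val_inj.
  rewrite -/y -/z !(rmorphM, rmorphD, rmorph1, rmorphXn) /=; ring.
have e0 (t : R) : 0 < (expR t)%:C by rewrite ltcR expR_gt0.
rewrite mulr_gt0 //; have [y0|y0] := eqVneq y 0; last first.
  by rewrite ltr_wpDr ?exprn_ge0 // mulr_gt0 // exprn_gt0 // normr_gt0.
have z0 : z != 0.
  apply: contraNneq u0 => z0; apply/eqP/rowP => i; rewrite mxE.
  by case: i => [[|[|//]] ?]; [rewrite -[RHS]y0|rewrite -[RHS]z0];
    congr (u _ _); exact/val_inj.
by rewrite y0 normr0 expr0n !mulr0 !add0r exprn_gt0 // normr_gt0.
Qed.

Lemma Wfun_moments (k : nat) (i j : 'I_2) :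
  cintegrable (open_interval -oo +oo) (fun x => (x ^+ k)%:C * Wfun x i j).
Proof.
rewrite open_interval_setT.
pose g x := x ^+ k * (expR (- x ^+ 2) *
  nth 0 (nth [::] [:: [:: expR (2 * b * x) + a ^+ 2 * x ^+ 2; a * x];
                      [:: a * x; 1]] i) j).
have -> : (fun x => (x ^+ k)%:C * Wfun x i j) = (fun x => (g x)%:C).
  by apply/funext => x; rewrite !mxE -rmorphM.
split; last by apply: eq_integrable (integrable0 _ _).
have m0 n : mu.-integrable setT (fun x => (x ^+ n * expR (- x ^+ 2))%:E).
  apply: eq_integrable (integrable_gauss_moment 0 n) => // x _.
  by rewrite mul0r addr0.
have m1 : mu.-integrable setT (fun x => (a * x * x ^+ k * expR (- x ^+ 2))%:E).
  apply: eq_integrable (integrableZl measurableT a (m0 k.+1)) => // x _.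
  by rewrite -EFinM exprS !mulrA.
rewrite /g; case: i j {g} => [[|[|//]] ?] [[|[|//]] ?] /=.
- have H1 := integrableD measurableT (integrable_gauss_moment (2 * b) k)
    (integrableZl measurableT (a ^+ 2) (m0 k.+2)).
  apply: eq_integrable H1 => // x _ /=.
  rewrite -EFinM -EFinD expRD !exprS; congr (_%:E); ring.
- by apply: eq_integrable m1 => // x _; congr _%:E; ring.
- by apply: eq_integrable m1 => // x _; congr _%:E; ring.
- by apply: eq_integrable (m0 k) => // x _; rewrite mulr1.
Qed.

Lemma Wfun_ae : {ae mu, forall x, open_interval -oo +oo x -> posdefmx (Wfun x)}.
Proof. by apply: aeW => x _; exact: Wfun_posdef. Qed.

Definition W : weight_matrix R 2 :=
  @WeightMatrix R 2 -oo +oo Wfun isT Wfun_ae Wfun_moments.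

End TheWeight.

(* Main.v *)
From HB Require Import structures.
Require Import Defs.
From mathcomp Require Import all_boot all_order all_algebra.
From mathcomp Require Import fraction spectral complex.
From mathcomp Require Import all_classical all_reals all_analysis.
From mathcomp Require Import measurable_realfun ring lra.

(** Write [W = T diag(e^{-x^2+2bx}, e^{-x^2}) T^*] with [T = [[1, ax], [0, 1]]],
    and let [La], [Lb] be integration against the two Gaussians.  If
    [c_n Pt_n f = P_n . D], orthogonality of [Pt_n] shows, with
    [Q = P_n . D], that [La (Q_{k0} q)] and [Lb ((a x Q_{k0} + Q_{k1}) q)] vanish
    for [n] large.  As [P_n = diag(p_n^0, p_n^1)], integration by parts turns
    these into [La (p_n^k h_q) = 0] and [Lb (p_n^k g_q) = 0], with [h_q], [g_q]
    polynomials independent of [n], so [La (. h_q)] and [Lb (. g_q)] are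
    polynomial multiples [M_k (. r)], [M_k (. s)] of the moment functional of the
    [k]-th diagonal weight.  Hence [La (. h_q s) = Lb (. g_q r)], which
    forces [h_q = 0] or [g_q = 0], because distinct Gaussians are linearly
    independent over the polynomials.  So row [k] of [c_n Pt_n] is
    [(0, t)] or [(u, - a x u)]; having degree at most [n], its first entry has
    degree less than [n], so the first column of [c_n] is zero and
    [c_n] is singular. *)

Set Implicit Arguments.
Unset Strict Implicit.
Unset Printing Implicit Defensive.

Import Order.TTheory GRing.Theory Num.Theory.
Import numFieldNormedType.Exports.

Local Open Scope ring_scope.

(** * Complex-valued integrals: linearity, finite sums, vanishing of nonnegative integrands *)

Section ComplexIntegral.
Local Open Scope complex_scope.
Variable R : realType.
Local Notation C := R[i].
Local Notation mu := (@lebesgue_measure R).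
Variables (I : set R) (mI : @measurable _ (measurableTypeR R) I).
Implicit Types f g : R -> C.

Lemma cintegrableDZ (c : C) f g : cintegrable I f -> cintegrable I g ->
  cintegrable I (fun x => c * f x + g x).
Proof.
move=> [f1 f2] [g1 g2]; case: c => [c d]; split.
  have := integrableD mI (integrableB mI (integrableZl mI c f1)
    (integrableZl mI d f2)) g1.
  by apply: eq_integrable => // x _; case: (f x) (g x) => [? ?] [].
have := integrableD mI (integrableD mI (integrableZl mI c f2)
    (integrableZl mI d f1)) g2.
by apply: eq_integrable => // x _; case: (f x) (g x) => [? ?] [].
Qed.

Lemma cintegralDZ (c : C) f g : cintegrable I f -> cintegrable I g ->
  cintegral I (fun x => c * f x + g x) = c * cintegral I f + cintegral I g.
Proof.
move=> [f1 f2] [g1 g2]; case: c => [c d]; rewrite /cintegral.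
have Zl (k : R) (h : R -> R) : mu.-integrable I (EFin \o h) ->
  mu.-integrable I (EFin \o (fun x => k * h x)).
  by move=> /(integrableZl mI k); apply: eq_integrable.
rewrite [LHS](_ : _ =
  (\int[mu]_(x in I)
     (c * complex.Re (f x) + - d * complex.Im (f x) + complex.Re (g x))) +i*
  (\int[mu]_(x in I)
     (c * complex.Im (f x) + d * complex.Re (f x) + complex.Im (g x)))).
  rewrite !RintegralD ?RintegralZl //; try exact: Zl.
  - by rewrite mulNr.
  - have := integrableD mI (Zl c _ f2) (Zl d _ f1).
    by apply: eq_integrable.
  - have := integrableD mI (Zl c _ f1) (Zl (- d) _ f2).
    by apply: eq_integrable.
by congr (_ +i* _); apply: eq_Rintegral => x _;
  case: (f x) (g x) => [? ?] [? ?] //=; rewrite mulNr.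
Qed.

Lemma cintegrable0 : cintegrable I (fun=> 0).
Proof. by split; exact: integrable0. Qed.

Lemma cintegral0 : cintegral I (fun=> 0) = 0.
Proof.
rewrite /cintegral (_ : \int[mu]_(x in I) 0 = 0) //.
by rewrite Rintegral_cst // mul0r.
Qed.

Lemma eq_cintegral f g : (forall x, I x -> f x = g x) ->
  cintegral I f = cintegral I g.
Proof.
by move=> fg; rewrite /cintegral; congr (_ +i* _); apply: eq_Rintegral => x;
  rewrite inE => /fg ->.
Qed.

(** Both halves share one induction, since additivity of the integral needs integrability of the
    partial sums. *)
Lemma cintegrable_cintegral_sum (T : finType) (F : T -> R -> C) :
  (forall i, cintegrable I (F i)) ->
  cintegrable I (fun x => \sum_i F i x) /\
  cintegral I (fun x => \sum_i F i x) = \sum_i cintegral I (F i).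
Proof.
move=> iF.
elim: (index_enum T) => [|i s [IH1 IH2]].
  rewrite big_nil (_ : (fun _ => _) = fun=> 0); last first.
    by apply/funext => x; rewrite big_nil.
  by split; [exact: cintegrable0|exact: cintegral0].
rewrite big_cons (_ : (fun _ => _) = fun x => 1 * F i x + \sum_(i <- s) F i x).
  by split; [exact: cintegrableDZ|rewrite cintegralDZ // mul1r IH2].
by apply/funext => x; rewrite big_cons mul1r.
Qed.

(* Nonnegativity in [R[i]] includes being real. *)
Lemma cintegral_eq0_ae f : cintegrable I f ->
  (\forall x \ae mu, I x -> 0 <= f x) -> cintegral I f = 0 ->
  \forall x \ae mu, I x -> f x = 0.
Proof.
move=> [f1 f2] f0 /(congr1 (@complex.Re R)) /= If0.
have mf := measurable_int mu f1.
have absE : ae_eq mu I (fun x => `|(complex.Re (f x))%:E|)%E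
    (fun x => (complex.Re (f x))%:E).
  apply: (@filterS _ _ (ae_filter_ringOfSetsType mu) _ _ _ f0) => x fx Ix.
  move: (fx Ix); rewrite lecE /= => /andP[_ ?].
  by rewrite ger0_norm.
have : (\int[mu]_(x in I) `|(complex.Re (f x))%:E| = 0)%E.
  rewrite (ae_eq_integral _ _ mI _ mf absE); last exact: measurableT_comp.
  have /fineK <- : (\int[mu]_(x in I) (complex.Re (f x))%:E)%E \is a fin_num.
    exact: integrable_fin_num.
  by rewrite -[fine _]/(\int[mu]_(x in I) (complex.Re (f x))) If0.
move/(ae_eq_integral_abs mu mI mf) => H.
apply: (@filterS2 _ _ (ae_filter_ringOfSetsType mu) _ _ _ _ f0 H).
move=> x fx Rx Ix; move: (fx Ix) (Rx Ix).
by case: (f x) => [u v]; rewrite lecE /= => /andP[/eqP-> _] [->].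
Qed.

End ComplexIntegral.

(** * Integration against a weight as a linear functional on polynomials *)

Section PolyMoment.
Local Open Scope complex_scope.
Variable R : realType.
Local Notation C := R[i].

Definition polymom (I : set R) (w : R -> C) (p : {poly C}) : C :=
  cintegral I (fun x => p.[x%:C] * w x).

Definition has_moments (I : set R) (w : R -> C) :=
  forall k : nat, cintegrable I (fun x => (x ^+ k)%:C * w x).

Variables (I : set R) (mI : @measurable _ (measurableTypeR R) I).

Lemma polymom_integrable w p : has_moments I w ->
  cintegrable I (fun x => p.[x%:C] * w x).
Proof.
move=> Iw; have [H _] := cintegrable_cintegral_sum mI
  (fun i : 'I_(size p) => cintegrableDZ mI p`_i (Iw i) (cintegrable0 I)).
congr (cintegrable I _): H; apply/funext => x.
rewrite horner_coef mulr_suml; apply: eq_bigr => i _.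
by rewrite addr0 mulrA rmorphXn.
Qed.

Lemma polymom_linear w : has_moments I w -> scalar (polymom I w).
Proof.
move=> Iw c p q; rewrite /polymom -cintegralDZ //; try exact: polymom_integrable.
by congr (cintegral I _); apply/funext => x;
  rewrite hornerD hornerZ mulrDl mulrA.
Qed.

End PolyMoment.

(** * Integration by parts for Gaussian moments *)

Section GaussianParts.
Local Open Scope classical_set_scope.
Variable R : realType.
Local Notation mu := (@lebesgue_measure R).

(** The truncations of [f] to [[-n, n]] are dominated by [|f|], so their integrals tend to that of
    [f]; by the fundamental theorem of calculus these are [F n - F (- n)], which tends to 0. *)
Lemma Rintegral_derive_eq0 (F f : R -> R) :
  (forall x : R, is_derive x (1 : R) F (f x)) -> continuous f ->
  mu.-integrable setT (EFin \o f) ->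
  F n%:R @[n --> \oo] --> 0 -> F (- n%:R) @[n --> \oo] --> 0 ->
  \int[mu]_x f x = 0.
Proof.
move=> dF cf If F0 F0'.
pose f_ n : measurableTypeR R -> \bar R := (EFin \o f) \_ `[- n%:R, n%:R].
have mf := measurable_int mu If.
have [||||| _ _ H] := @dominated_convergence _ _ R mu setT measurableT
  f_ (EFin \o f) (fun x => `|(f x)%:E|)%E.
- move=> n; apply/measurable_restrict => //; rewrite setTI.
  exact: measurable_funS mf.
- exact: mf.
- apply: aeW => x _; apply: cvg_near_cst.
  exists (Num.bound `|x|) => // n /= xn; rewrite /f_ patchE mem_set //=.
  rewrite in_itv /= -ler_norml ltW // (lt_le_trans (archi_boundP _)) //.
  by rewrite ler_nat.
- exact: integrable_abse If.
- apply: aeW => x n _; rewrite /f_ patchE; case: ifP => //.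
  by rewrite abse0.
(* The index is [n.+1] because the fundamental theorem is applied on an interval with distinct
   endpoints. *)
have E n : (\int[mu]_(x in setT) f_ n.+1 x = (F n.+1%:R - F (- n.+1%:R))%:E)%E.
  rewrite /f_ -integral_mkcond EFinB -(@continuous_FTC2 _ f F) //.
  - by rewrite (@lt_trans _ _ 0) ?oppr_lt0.
  - exact: continuous_subspaceT.
  - split; first by move=> x _; exact: ex_derive.
      apply: cvg_at_right_filter; apply: differentiable_continuous.
      by apply/derivable1_diffP/ex_derive.
    apply: cvg_at_left_filter; apply: differentiable_continuous.
    by apply/derivable1_diffP/ex_derive.
  - by move=> x _; rewrite derive1E derive_val.
have H0 : (\int[mu]_(x in setT) f_ n.+1 x)%E @[n --> \oo] --> 0%E.
  under eq_fun do rewrite E.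
  apply: cvg_EFin; first exact: nearW.
  have := cvgB F0 F0'; rewrite subr0 -cvg_shiftS; exact.
move: H; rewrite -cvg_shiftS => H.
by rewrite /Rintegral (cvg_unique (@ereal_hausdorff R) H H0).
Qed.

(** Completing the square bounds [(|c| + 2) |x| - x ^+ 2] by [(|c| + 2) ^+ 2 / 4]. Of the extra
    [2 |x|], one [|x|] absorbs the monomial and the other remains as decay. *)
Lemma gauss_decay (k : nat) (c : R) :
  exists K, forall x, `|x ^+ k * expR (- x ^+ 2 + c * x)| <= K * expR (- `|x|).
Proof.
exists (k`!%:R * 2 * expR ((`|c| + 2) ^+ 2 / 4)) => x.
rewrite normrM (ger0_norm (expR_ge0 _)) -!mulrA -expRD.
have H : expR x + expR (- x) <= 2 * expR `|x|.
  rewrite mulr2n mulrDl mul1r lerD // ler_expR ?ler_norm //.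
  by rewrite -normrN ler_norm.
apply: (@le_trans _ _ (k`!%:R * (2 * expR `|x|) * expR (- x ^+ 2 + c * x))).
  rewrite ler_pM2r ?expR_gt0 //; apply: (le_trans (expr_le_expR k x)).
  by rewrite ler_wpM2l.
rewrite -!mulrA -expRD !ler_pM2l ?ltr0n ?fact_gt0 // ler_expR.
have cx : c * x <= `|c| * `|x| by rewrite -normrM ler_norm.
rewrite -(real_normK (num_real x)).
have := sqr_ge0 (`|x| - (`|c| + 2) / 2); nra.
Qed.

Lemma gauss_cvg0 (k : nat) (c : R) (u : R ^nat) : (forall n, `|u n| = n%:R) ->
  u n ^+ k * expR (- u n ^+ 2 + c * u n) @[n --> \oo] --> 0.
Proof.
move=> un; have [K HK] := gauss_decay k c.
apply/norm_cvg0P; apply: (@squeeze_cvgr _ _ _ _ (fun=> 0) (fun n => K * expR (- n%:R))).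
- by apply: nearW => n; rewrite normr_ge0 -(un n) HK.
- exact: cvg_cst.
- rewrite -(mulr0 K); apply: cvgMr; exact: cvgn_expR.
Qed.

Definition gauss_monomial (c : R) (k : nat) (x : R) : R :=
  x ^+ k * expR (- x ^+ 2 + c * x).

(** At [k = 0] the truncated index [k.-1] is harmless, its coefficient being 0. *)
Lemma is_derive_gauss_monomial c k (x : R) :
  is_derive x (1 : R) (gauss_monomial c k) (k%:R * gauss_monomial c k.-1 x
    - 2 * gauss_monomial c k.+1 x + c * gauss_monomial c k x).
Proof.
have d1 : is_derive x 1 (fun x : R => - x ^+ 2 + c * x) (- (2 * x) + c).
  apply: is_derive_eq; rewrite -[x%:A]/(x * 1) -[c%:A]/(c * 1); ring.
have d2 := is_derive1_comp (is_derive_expR _) d1.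
have d3 : is_derive x 1 (fun x : R => x ^+ k) (k%:R * x ^+ k.-1).
  by apply: DeriveDef; [exact: exprn_derivable|rewrite exp_derive [LHS]mulr1].
have := is_deriveM d3 d2; congr (is_derive _ _ _ _).
rewrite /gauss_monomial /GRing.scale /= !exprS; ring.
Qed.

Lemma continuous_gauss_monomial c k : continuous (gauss_monomial c k).
Proof.
move=> x; apply/differentiable_continuous/derivable1_diffP.
exact: (@ex_derive _ _ _ _ _ _ _ (is_derive_gauss_monomial c k x)).
Qed.

Definition gauss_moment (c : R) (k : nat) : R :=
  \int[mu]_x gauss_monomial c k x.

(** This is the integral over the line of the derivative of [gauss_monomial c k], which vanishes by
    decay at both ends. *)
Lemma gauss_moment_rec c k :
  k%:R * gauss_moment c k.-1 - 2 * gauss_moment c k.+1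
  + c * gauss_moment c k = 0.
Proof.
have I j : mu.-integrable setT (EFin \o gauss_monomial c j).
  exact: integrable_gauss_moment.
have IZ (r : R) j : mu.-integrable setT (EFin \o (fun x => r * gauss_monomial c j x)).
  by have := integrableZl measurableT r (I j); apply: eq_integrable.
have IB := integrableB measurableT (IZ k%:R k.-1) (IZ 2 k.+1).
rewrite /gauss_moment -!RintegralZl // -RintegralB // -RintegralD //.
apply: (@Rintegral_derive_eq0 (gauss_monomial c k)).
- exact: is_derive_gauss_monomial.
- by move=> x; apply: cvgD; [apply: cvgB|]; apply: cvgM; try exact: cvg_cst;
    exact: continuous_gauss_monomial.
- by have := integrableD measurableT IB (IZ c k); apply: eq_integrable.
- by apply: (@gauss_cvg0 k c (fun n => n%:R)) => n; rewrite normr_nat.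
- by apply: (@gauss_cvg0 k c (fun n => - n%:R)) => n; rewrite normrN normr_nat.
Qed.
End GaussianParts.

(** * Algebra of linear functionals satisfying a Pearson equation *)

Section Functionals.
Variable F : fieldType.
Implicit Types (L M : {scalar {poly F}}) (f g p q phi : {poly F}).

(* Holds for integration against [w] when [w' = - phi * w]. *)
Definition pearson L phi := forall g, L g^`() = L (phi * g).

Definition nondegenerate L := forall g, (forall f, L (f * g) = 0) -> g = 0.

Lemma pearson_monomials L phi :
  (forall k, L ('X^k)^`() = L (phi * 'X^k)) -> pearson L phi.
Proof.
move=> Lk g; rewrite -[g]coefK poly_def (raddf_sum (@deriv F)) mulr_sumr !linear_sum.
by apply: eq_bigr => k _; rewrite /= derivZ -scalerAr !linearZ /= Lk.
Qed.

(** The adjoint of differentiation for a functional [L] with [pearson L phi]. *)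
Definition deriv_adj phi g := phi * g - g^`().

Lemma pearson_deriv L phi f g : pearson L phi ->
  L (f^`() * g) = L (f * deriv_adj phi g).
Proof.
move=> Lphi; rewrite /deriv_adj mulrBr linearB /=.
have -> : f * (phi * g) = phi * (f * g) by rewrite mulrCA.
by rewrite -Lphi derivM linearD /= addrK.
Qed.

Lemma pearson_derivn L phi j f g : pearson L phi ->
  L (f^`(j) * g) = L (f * iter j (deriv_adj phi) g).
Proof.
move=> Lphi; elim: j g => [//|j IH] g.
by rewrite derivnS (pearson_deriv _ _ Lphi) IH -iterSr.
Qed.

Definition apply_op (E : seq {poly F}) f := \sum_(j < size E) f^`(j) * E`_j.

(** The formal adjoint of [apply_op E], evaluated at [q]. It does not involve the polynomial [f]
    acted upon, so one [op_adj phi E q] serves a whole orthogonal sequence. *)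
Definition op_adj phi (E : seq {poly F}) q :=
  \sum_(j < size E) iter j (deriv_adj phi) (E`_j * q).

Lemma op_adjP L phi E f q : pearson L phi ->
  L (apply_op E f * q) = L (f * op_adj phi E q).
Proof.
move=> Lphi; rewrite /apply_op mulr_suml mulr_sumr !linear_sum /=.
by apply: eq_bigr => j _; rewrite -mulrA (pearson_derivn _ _ _ Lphi).
Qed.

Lemma size_derivDZ (c : F) p : c != 0 -> size (p^`() + c *: p) = size p.
Proof.
move=> c0; have [->|p0] := eqVneq p 0; first by rewrite deriv0 scaler0 addr0.
by rewrite addrC size_polyDl size_scale // lt_size_deriv.
Qed.

(* The operator [f |-> phi * f - f^`()] is adjoint to [deriv] for [Lb] but to
   the degree-preserving [deriv + c] for [La]. *)
Lemma pearson_independent La Lb phi (c : F) A B :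
  c != 0 -> pearson Lb phi -> pearson La (phi - c%:P) -> nondegenerate La ->
  (forall f, La (f * A) = Lb (f * B)) -> A = 0.
Proof.
move=> c0 Lbphi Laphi La_nd AB.
pose up n f := iter n (deriv_adj phi) f.
pose dn n g := iter n (fun g => g^`() + c *: g) g.
have Lb_up n f g : Lb (up n f * g) = Lb (f * g^`(n)).
  elim: n g => [//|n IH] g.
  by rewrite /up iterS mulrC -(pearson_deriv _ _ Lbphi) mulrC IH -derivSn.
have La_up n f g : La (up n f * g) = La (f * dn n g).
  elim: n g => [//|n IH] g.
  rewrite /up iterS -/(up n f) /dn iterSr -/(dn n _) -IH.
  have := pearson_deriv (up n f) g Laphi; rewrite /deriv_adj.
  set u := up n f => E.
  have -> : (phi * u - u^`()) * g = phi * u * g - u^`() * g by ring.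
  rewrite linearB /= E -linearB /=; congr (La _).
  by rewrite -mul_polyC; ring.
have size_dn n g : size (dn n g) = size g.
  by elim: n => [//|n IH]; rewrite /dn iterS size_derivDZ.
(* Moving [size B] factors across annihilates [B] on the [Lb] side, while on the [La] side [dn]
   keeps the size of [A]. *)
apply/eqP; rewrite -size_poly_eq0 -(size_dn (size B)) size_poly_eq0.
apply/eqP/La_nd => f; rewrite -La_up AB Lb_up.
by rewrite derivn_poly0 // mulr0 linear0.
Qed.

(** Both [La (f * (h * s))] and [Lb (f * (k * r))] equal [M (f * (r * s))], so [pearson_independent]
    gives [h * s = 0]. If [s = 0], then [Lb] vanishes on all multiples of [k], and nondegeneracy
    forces [k = 0]. *)
Lemma pearson_dichotomy La Lb M phi (c : F) h k r s :
  c != 0 -> pearson Lb phi -> pearson La (phi - c%:P) ->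
  nondegenerate La -> nondegenerate Lb ->
  (forall f, La (f * h) = M (f * r)) -> (forall f, Lb (f * k) = M (f * s)) ->
  h = 0 \/ k = 0.
Proof.
move=> c0 Lbphi Laphi La_nd Lb_nd hr ks.
have /eqP : h * s = 0.
  apply: (@pearson_independent La Lb phi c _ (k * r)) => // f.
  by rewrite [h * s]mulrC [k * r]mulrC !mulrA hr ks -!mulrA [s * r]mulrC.
rewrite mulf_eq0 => /orP[/eqP|/eqP s0]; first by left.
by right; apply: Lb_nd => f; rewrite ks s0 mulr0 linear0.
Qed.

Lemma monic_seq_span (u : {scalar {poly F}}) (p : nat -> {poly F}) :
  (forall n, (size (p n - 'X^n)%R <= n)%N) -> (forall n, u (p n) = 0) ->
  forall f, u f = 0.
Proof.
move=> p_monic up f; have [n] := ubnP (size f).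
elim: n f => [//|n IH] f; rewrite ltnS => sf.
(* Here [size f <= n], so subtracting this multiple of the monic [p n.-1] cancels the top
   coefficient. *)
have -> : f = (f - f`_n.-1 *: p n.-1) + f`_n.-1 *: p n.-1 by rewrite subrK.
rewrite addrC linearP /= up mulr0 add0r.
case: n IH sf => [|n] IH /= sf.
  by move: sf; rewrite leqn0 size_poly_eq0 => /eqP->; rewrite coef0 scale0r subr0 linear0.
apply: IH; rewrite ltnS; apply/leq_sizeP => j nj; rewrite coefB coefZ.
have : (p n - 'X^n)`_j = 0 by have /leq_sizeP := p_monic n; apply.
rewrite coefB coefXn => /eqP; rewrite subr_eq0 => /eqP->.
move: nj; rewrite leq_eqVlt => /orP[/eqP->|nj]; first by rewrite eqxx mulr1 subrr.
by have /leq_sizeP := sf; rewrite gtn_eqF // mulr0 subr0; apply.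
Qed.

(** A functional vanishing on all but finitely many [p n] has a finite biorthogonal expansion: [r]
    is chosen so that [u] and [M (_ * r)] agree on every [p n], and these span. *)
Lemma functional_of_kernel (u M : {scalar {poly F}}) (p q : nat -> {poly F}) N :
  (forall n, (size (p n - 'X^n)%R <= n)%N) ->
  (forall n m, n != m -> M (p n * q m) = 0) ->
  (forall n, M (p n * q n) != 0) ->
  (forall n, (N <= n)%N -> u (p n) = 0) ->
  exists r, forall f, u f = M (f * r).
Proof.
move=> p_monic Mpq0 Mpq uN.
pose r := \sum_(m < N) (u (p m) / M (p m * q m)) *: q m; exists r => f.
pose v g := u g - M (g * r).
have v_lin : linear_for *%R v.
  move=> c g h; rewrite /v mulrDl -scalerAl !linearP /=; ring.
pose v' : {scalar {poly F}} :=
  HB.pack v (GRing.isLinear.Build F {poly F} F *%R v v_lin).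
have vp n : v (p n) = 0.
  rewrite /v /r mulr_sumr linear_sum /=.
  apply/eqP; rewrite subr_eq0; apply/eqP; have [nN|Nn] := ltnP n N.
    rewrite (bigD1 (Ordinal nN)) //= -scalerAr linearZ /= divfK // big1 ?addr0 //.
    move=> m mn; rewrite -scalerAr linearZ /= (Mpq0 n m) ?mulr0 //.
    by apply: contra mn => /eqP nm; apply/eqP/val_inj.
  rewrite uN // big1 // => m _; rewrite -scalerAr linearZ /= (Mpq0 n m) ?mulr0 //.
  by rewrite gtn_eqF // (leq_trans (ltn_ord m)).
by have /eqP := @monic_seq_span v' p p_monic vp f; rewrite /= subr_eq0 => /eqP.
Qed.

End Functionals.

(** * The sesquilinear form on polynomial rows, and orthogonality for direct sums *)

Section MomentForms.
Local Open Scope complex_scope.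
Local Open Scope sesquilinear_scope.
Variable R : realType.
Local Notation C := R[i].
Local Notation mu := (@lebesgue_measure R).

Definition polymom_form (I : set R) (mI : @measurable _ (measurableTypeR R) I)
    (w : R -> C) (Iw : has_moments I w) : {scalar {poly C}} :=
  HB.pack (polymom I w)
    (GRing.isLinear.Build C {poly C} C *%R _ (polymom_linear mI Iw)).

(** Integration runs over real points, where conjugating coefficients conjugates values; the form
    thus reduces to linear functionals of a product. *)
Definition conj_poly (p : {poly C}) : {poly C} := map_poly Num.conj p.

Lemma conj_polyK : involutive conj_poly.
Proof.
by move=> p; apply/polyP => i; rewrite !coef_map_id0 ?conjC0 // conjCK.
Qed.

Lemma size_conj_poly p : size (conj_poly p) = size p.
Proof. exact: size_map_poly. Qed.

Lemma conj_polyM p q : conj_poly (p * q) = conj_poly p * conj_poly q.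
Proof. exact: rmorphM. Qed.

Lemma conj_polyD p q : conj_poly (p + q) = conj_poly p + conj_poly q.
Proof. exact: rmorphD. Qed.

Lemma conj_poly0 : conj_poly 0 = 0.
Proof. exact: rmorph0. Qed.

Lemma horner_conj_poly p (x : R) : (conj_poly p).[x%:C] = (p.[x%:C])^*%R.
Proof.
by rewrite -horner_map /=; congr (_.[_]); apply/esym; exact: conjc_real.
Qed.

Section Form.
Variables (N : nat) (V : weight_matrix R N).
Implicit Types v w : 'rV[{poly C}]_N.

Lemma measurable_wm_supp : @measurable _ (measurableTypeR R) (wm_supp V).
Proof.
rewrite /wm_supp /open_interval.
have -> : [set x | (wm_x0 V < x%:E < wm_x1 V)%E]%classic =
  ([set x | (wm_x0 V < x%:E)%E] `&` [set x | (x%:E < wm_x1 V)%E])%classic.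
  by apply/seteqP; split => x /=; [move/andP|move=> [? ?]; apply/andP].
apply: measurableI.
  case: (wm_x0 V) => [r||].
  - rewrite (_ : [set _ | _]%classic = `]r, +oo[%classic) //.
    by apply/seteqP; split => x /=; rewrite in_itv /= andbT lte_fin.
  - by rewrite (_ : [set _ | _]%classic = set0) //; apply/seteqP; split.
  - rewrite (_ : [set _ | _]%classic = setT) //.
    by apply/seteqP; split => // x _ /=; rewrite ltNyr.
case: (wm_x1 V) => [r||].
- rewrite (_ : [set _ | _]%classic = `]-oo, r[%classic) //; exact: measurable_itv.
- rewrite (_ : [set _ | _]%classic = setT) //.
  by apply/seteqP; split => // x _ /=; rewrite ltry.
- by rewrite (_ : [set _ | _]%classic = set0) //; apply/seteqP; split.
Qed.

(** The interval, possibly unbounded, contains a bounded open one of positive length. *)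
Lemma wm_supp_not_negligible : ~ mu.-negligible (wm_supp V).
Proof.
have [r [s [rs sub]]] : exists r s : R, r < s /\ (`]r, s[ `<=` wm_supp V)%classic.
  rewrite /wm_supp /open_interval; have := wm_lt V.
  case: (wm_x0 V) (wm_x1 V) => [r||] [s||] //=.
  - rewrite lte_fin => rs; by exists r, s; split=> // x /=.
  - move=> _; exists r, (r + 1); split; first by rewrite ltrDl.
    by move=> x /= /[!in_itv] /= /andP[rx _]; rewrite ltry andbT.
  - move=> _; exists (s - 1), s; split; first by rewrite ltrBlDr ltrDl.
    by move=> x /= /[!in_itv] /= /andP[_ xs]; rewrite ltNyr.
  - move=> _; exists 0, 1; split; first exact: ltr01.
    by move=> x _ /=; rewrite ltry ltNyr.
move=> [B [mB B0 VB]].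
have neg : mu.-negligible `]r, s[%classic.
  by exists B; split=> //; exact: subset_trans VB.
have mrs : @measurable _ (measurableTypeR R) `]r, s[%classic.
  exact: measurable_itv.
have /eqP := measure_negligible mrs neg.
by rewrite [X in X == _]lebesgue_measure_itv /= lte_fin rs -EFinB eqe subr_eq0 gt_eqF.
Qed.

Lemma wm_has_moments k l : has_moments (wm_supp V) (fun x => V x k l).
Proof. by move=> n; exact: wm_moments. Qed.

Definition moment k l := polymom_form measurable_wm_supp (wm_has_moments k l).

(** The form [wm_form] on single rows, expanded into moment functionals so that later arguments are
    algebraic; [rowformE] links it back to the integral. *)
Definition rowform v w : C := \sum_k \sum_l moment k l (v 0 k * conj_poly (w 0 l)).

Definition row_eval v (x : R) : 'rV[C]_N := map_mx (fun p : {poly C} => p.[x%:C]) v.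

Lemma rowformE v w :
  let F x := (row_eval v x *m V x *m (row_eval w x) ^t*) 0 0 in
  cintegrable (wm_supp V) F /\ cintegral (wm_supp V) F = rowform v w.
Proof.
move=> F.
have [H1 H2] := cintegrable_cintegral_sum measurable_wm_supp
  (fun kl : 'I_N * 'I_N =>
     polymom_integrable measurable_wm_supp (v 0 kl.1 * conj_poly (w 0 kl.2))
       (wm_has_moments kl.1 kl.2)).
rewrite (_ : F = fun x => \sum_(kl : 'I_N * 'I_N)
     (v 0 kl.1 * conj_poly (w 0 kl.2)).[x%:C] * V x kl.1 kl.2).
  split=> //; rewrite H2 /rowform pair_bigA /=; exact: eq_bigr.
apply/funext => x; rewrite /F !mxE.
under eq_bigr do rewrite !mxE mulr_suml.
rewrite exchange_big pair_bigA /=; apply: eq_bigr => -[k l] _ /=.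
by rewrite !mxE hornerM horner_conj_poly mulrAC.
Qed.

Lemma wm_formE P Q i j : wm_form V P Q i j = rowform (row i P) (row j Q).
Proof.
have [_ <-] := rowformE (row i P) (row j Q); rewrite mxE.
congr (cintegral _ _); apply/funext => x; rewrite !mxE.
apply: eq_bigr => l _; rewrite !mxE; congr (_ * _).
by apply: eq_bigr => k _; rewrite !mxE.
Qed.

(** A real root is its own real part, so the real roots lie among the real parts of the finitely
    many complex ones. *)
Lemma negligible_poly_roots (p : {poly C}) : p != 0 ->
  mu.-negligible [set x | p.[x%:C] = 0]%classic.
Proof.
move=> p0; have [s ps] := closed_field_poly_normal p.
pose Z := [set` map (@complex.Re R) s]%classic.
have finZ : finite_set Z by exact: finite_seq.
exists Z; split.
- apply: (@countable_measurable _ (measurableTypeR R)) => [t|].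
    exact: measurable_set1.
  exact: finite_set_countable.
- exact/countable_lebesgue_measure0/finite_set_countable.
move=> x /= px; apply/mapP; exists x%:C => //.
move/eqP: px; rewrite -[_ == 0]/(root p x%:C) ps rootZ ?lead_coef_eq0 //.
by rewrite root_prod_XsubC.
Qed.

(** The integrand is nonnegative with zero integral, so [v] evaluates to zero almost everywhere on
    the support. A nonzero entry has only negligibly many roots, which would make the support
    negligible. *)
Lemma rowform_eq0 v : rowform v v = 0 -> v = 0.
Proof.
have [iF <-] := rowformE v v => If.
have pd := wm_posdef V.
apply: contrapT => /eqP v0.
have [k vk0] : exists k, v 0 k != 0.
  apply: contrapT => /forallNP h; case/negP: v0; apply/eqP/rowP => k.
  by rewrite mxE; apply/eqP; apply: contrapT => /negP; exact: h.
apply: wm_supp_not_negligible.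
pose ev x := row_eval v x.
have Vpos x : posdefmx (V x) -> 0 <= (ev x *m V x *m (ev x) ^t*) 0 0 ?= iff (ev x == 0).
  move=> [_ Vx]; have [->|vx0] := eqVneq (ev x) 0.
    by rewrite !mul0mx mxE; apply/leifP; rewrite eqxx.
  by apply/leifP; exact: Vx.
have F0 : \forall x \ae mu, wm_supp V x -> 0 <= (ev x *m V x *m (ev x) ^t*) 0 0.
  apply: (@filterS _ _ (ae_filter_ringOfSetsType mu) _ _ _ pd) => x Vx Ix.
  exact: Vpos (Vx Ix).
have F1 := cintegral_eq0_ae measurable_wm_supp iF F0 If.
have v_ae0 : \forall x \ae mu, wm_supp V x -> (v 0 k).[x%:C] = 0.
  apply: (@filterS2 _ _ (ae_filter_ringOfSetsType mu) _ _ _ _ pd F1).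
  move=> x Vx Fx Ix; have [_] := Vpos x (Vx Ix).
  by rewrite (Fx Ix) eqxx => /esym/eqP/rowP/(_ k); rewrite !mxE.
have [A [mA A0 hA]] := v_ae0; have [B [mB B0 hB]] := negligible_poly_roots vk0.
exists (A `|` B)%classic; split.
- exact: measurableU.
- exact: null_set_setU.
move=> x Ix; have [xB|xB] := pselect ((v 0 k).[x%:C] = 0).
  by right; exact: hB.
by left; apply: hA => /= /(_ Ix).
Qed.

Lemma rowformDZr v w1 w2 (c : C) :
  rowform v (c%:P *: w1 + w2) = c^*%R * rowform v w1 + rowform v w2.
Proof.
rewrite /rowform mulr_sumr -big_split; apply: eq_bigr => k _ /=.
rewrite mulr_sumr -big_split; apply: eq_bigr => l _ /=.
rewrite !mxE conj_polyD conj_polyM /conj_poly map_polyC /= mul_polyC mulrDr.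
by rewrite -scalerAr; exact: (linearP (moment k l)).
Qed.

Lemma rowformDZl v1 v2 w (c : C) :
  rowform (c%:P *: v1 + v2) w = c * rowform v1 w + rowform v2 w.
Proof.
rewrite /rowform mulr_sumr -big_split; apply: eq_bigr => k _ /=.
rewrite mulr_sumr -big_split; apply: eq_bigr => l _ /=.
by rewrite !mxE mul_polyC mulrDl -scalerAl; exact: (linearP (moment k l)).
Qed.

Lemma rowform0l w : rowform 0 w = 0.
Proof.
rewrite /rowform big1 // => k _; rewrite big1 // => l _.
by rewrite mxE mul0r; exact: (linear0 (moment k l)).
Qed.

Lemma rowform0r v : rowform v 0 = 0.
Proof.
by rewrite /rowform big1 // => k _; rewrite big1 // => l _;
  rewrite mxE conj_poly0 mulr0 linear0.
Qed.

Lemma rowformMl f v w : rowform (f *: v) w = rowform v (conj_poly f *: w).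
Proof.
rewrite /rowform; apply: eq_bigr => k _; apply: eq_bigr => l _.
by rewrite !mxE conj_polyM conj_polyK mulrCA mulrA.
Qed.

End Form.

(** Phrases, through a predicate [K] closed under combinations, that the rows of [P m] for [m < n]
    span all rows of degree below [n]. As [P n] has leading coefficient the identity, its rows
    weighted by the coefficients of ['X^n] in [v] remove the top degree. *)
Lemma monic_rows_span N (P : nat -> 'M[{poly C}]_N) (K : 'rV[{poly C}]_N -> Prop) n :
  (forall n, mxpoly_monic n (P n)) -> K 0 ->
  (forall (c : C) v w, K v -> K w -> K (c%:P *: v + w)) ->
  (forall m i, (m < n)%N -> K (row i (P m))) ->
  forall v : 'rV[{poly C}]_N, (forall j, (size (v 0%R j) <= n)%N) -> K v.
Proof.
move=> Pm K0 KD; elim: n => [|n IH] KP v sv.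
  rewrite (_ : v = 0) //; apply/rowP => j; rewrite mxE.
  by apply/eqP; rewrite -size_poly_leq0.
pose u := \sum_i ((v 0 i)`_n)%:P *: row i (P n).
have KZ (c : C) x : K x -> K (c%:P *: x).
  by move=> Kx; rewrite -[_ *: _]addr0; exact: KD.
have Kadd x y : K x -> K y -> K (x + y).
  by move=> Kx Ky; rewrite -[x]scale1r -polyC1; exact: KD.
have Ku : K u by apply: big_ind => // i _; apply/KZ/KP.
rewrite -(subrK u v); apply: Kadd Ku.
apply: IH => [m i mn|j]; first by apply: KP; exact: ltnW.
apply/leq_sizeP => m nm; rewrite !mxE coefB summxE coef_sum.
have Pmn i : (P n i j)`_m = ((i == j) && (m == n))%:R.
  have /leq_sizeP/(_ m nm) := Pm n i j; rewrite !mxE coefB => /eqP.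
  rewrite subr_eq0 => /eqP ->; rewrite coefMn coefXn.
  by case: (i == j); case: (m == n); rewrite ?mulr1n ?mulr0n.
under eq_bigr do rewrite !mxE coefCM Pmn.
rewrite (bigD1 j) //= eqxx /= big1 => [|i ij]; last first.
  by rewrite (negbTE ij) mulr0.
move: nm; rewrite addr0 leq_eqVlt => /orP[/eqP<-|nm].
  by rewrite eqxx mulr1 subrr.
by have /leq_sizeP := sv j; rewrite gtn_eqF // mulr0 subr0; apply.
Qed.

Lemma rowform_row_eq0 N (V : weight_matrix R N) P : monic_orthogonal V P ->
  forall n i (w : 'rV[{poly C}]_N), (forall j, (size (w 0%R j) <= n)%N) ->
  rowform V (row i (P n)) w = 0.
Proof.
move=> [Pm Po] n i; apply: (monic_rows_span Pm) => [|c v w v0 w0|m j mn].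
- exact: rowform0r.
- by rewrite rowformDZr v0 w0 mulr0 addr0.
- by rewrite -wm_formE Po ?mxE // gtn_eqF.
Qed.

Lemma moment_offdiag N (V : weight_matrix R N) k l p : direct_sum_classical V -> k != l ->
  moment V k l p = 0.
Proof.
move=> [w [_ Vw]] kl; rewrite /= -(cintegral0 (measurable_wm_supp V)).
by apply: eq_cintegral => x Vx; rewrite Vw // !mxE (negbTE kl) mulr0n mulr0.
Qed.

Lemma rowform_offdiag_row N (V : weight_matrix R N) (v w : 'rV[{poly C}]_N) l :
  direct_sum_classical V -> (forall k, k != l -> w 0 k = 0) ->
  rowform V v w = moment V l l (v 0 l * conj_poly (w 0 l)).
Proof.
move=> dV w0; rewrite /rowform exchange_big (bigD1 l) //= [X in _ + X]big1.
  rewrite addr0 (bigD1 l) //= [X in _ + X]big1 ?addr0 // => k kl.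
  exact: (moment_offdiag _ dV kl).
move=> k kl; rewrite big1 // => i _.
by rewrite w0 // conj_poly0 mulr0; exact: (linear0 (moment V i k)).
Qed.

(** The entry [P n k l] has degree below [n], so row [k] of [P n] is orthogonal to the row [w]
    carrying this entry alone in position [l]. For a diagonal weight that pairing equals the squared
    norm of [w]. *)
Lemma direct_sum_orthogonal_diag N (V : weight_matrix R N) P n k l :
  direct_sum_classical V -> monic_orthogonal V P -> k != l -> P n k l = 0.
Proof.
move=> dV oP kl; pose w : 'rV[{poly C}]_N := \row_j if j == l then P n k l else 0.
have wl : w 0 l = P n k l by rewrite mxE eqxx.
have w0 j : j != l -> w 0 j = 0 by move=> jl; rewrite mxE (negbTE jl).
rewrite -wl; suff -> : w = 0 by rewrite mxE.
apply: (@rowform_eq0 _ V); rewrite (rowform_offdiag_row _ dV w0) wl.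
have : rowform V (row k (P n)) w = 0.
  apply: (rowform_row_eq0 oP) => j; rewrite mxE; case: eqP => _; last by rewrite size_poly0.
  have := oP.1 n k l; rewrite !mxE (negbTE kl) mulr0n subr0; exact.
by rewrite (rowform_offdiag_row _ dV w0) wl mxE.
Qed.

Lemma diag_monic N (P : nat -> 'M[{poly C}]_N) k n :
  mxpoly_monic n (P n) -> (size (P n k k - 'X^n)%R <= n)%N.
Proof. by move=> /(_ k k); rewrite !mxE eqxx mulr1n. Qed.

(** Rows of [P n] have only their diagonal entry, so the matrix orthogonality is scalar
    orthogonality; a zero norm would annihilate a monic polynomial. *)
Lemma direct_sum_diag_orthogonal N (V : weight_matrix R N) P k :
  direct_sum_classical V -> monic_orthogonal V P ->
  (forall n m, n != m -> moment V k k (P n k k * conj_poly (P m k k)) = 0) /\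
  (forall n, moment V k k (P n k k * conj_poly (P n k k)) != 0).
Proof.
move=> dV oP.
have E n m : moment V k k (P n k k * conj_poly (P m k k)) = wm_form V (P n) (P m) k k.
  rewrite wm_formE (@rowform_offdiag_row _ _ _ _ k) ?mxE // => j jk.
  by rewrite mxE (direct_sum_orthogonal_diag _ dV oP) // eq_sym.
split=> [n m nm|n]; first by rewrite E oP.2 // mxE.
rewrite E wm_formE; apply: contra_neqN (oner_neq0 C) => /eqP/rowform_eq0/rowP/(_ k).
rewrite !mxE => Pn0; have /leq_sizeP/(_ n (leqnn n)) := diag_monic k (oP.1 n).
by rewrite Pn0 sub0r coefN coefXn eqxx => /eqP; rewrite oppr_eq0 => /eqP.
Qed.

End MomentForms.

(** * Reduction of differential operators from rational functions to polynomials *)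

Section Operators.
Variables (F : fieldType) (N : nat).
Implicit Types (Q : 'M[{poly F}]_N) (D : diffop F N).

Definition diffop_poly_act Q D : 'M[{poly F}]_N :=
  \sum_(j < size D) map_mx (fun p : {poly F} => p^`(j)) Q *m nth 0 D j.

Lemma diffop_act_mxfrac Q D :
  diffop_act (mxfrac Q) D = mxfrac (diffop_poly_act Q D).
Proof.
rewrite /diffop_act /mxfrac /diffop_poly_act raddf_sum; apply: eq_bigr => j _ /=.
rewrite map_mxM; congr (_ *m _); apply/matrixP => i k; rewrite !mxE.
by elim: (nat_of_ord j) => [//|n IH]; rewrite iterS IH frac_deriv_tofrac derivnS.
Qed.

Definition diffop_entry D i k : seq {poly F} := [seq M i k | M : 'M[{poly F}]_N <- D].

Lemma diffop_poly_act_diag Q D i k : (forall l, i != l -> Q i l = 0) ->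
  diffop_poly_act Q D i k = apply_op (diffop_entry D i k) (Q i i).
Proof.
move=> Qi; rewrite /diffop_poly_act summxE /apply_op size_map.
apply: eq_bigr => j _; rewrite mxE (bigD1 i) //= big1 ?addr0 => [|l li].
  by rewrite mxE (nth_map 0).
by rewrite mxE Qi 1?eq_sym // derivn_poly0 ?mul0r // size_poly0.
Qed.

Lemma mxfrac_inj : injective (@mxfrac F N).
Proof.
move=> Q1 Q2 /matrixP h; apply/matrixP => i j; have := h i j; rewrite !mxE.
by move/eqP; rewrite tofrac_eq => /eqP.
Qed.

(** Clearing the denominator [f] turns the Darboux relation into an identity of polynomial
    matrices. *)
Lemma darboux_poly (f : {poly F}) (A Q : 'M[{poly F}]_N) D : f != 0 ->
  mxfrac A = (tofrac f)^-1 *: diffop_act (mxfrac Q) D ->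
  diffop_poly_act Q D = f *: A.
Proof.
move=> f0 E; apply: mxfrac_inj; rewrite -diffop_act_mxfrac.
apply/matrixP => i j; move/matrixP/(_ i j): E; rewrite !mxE tofracM => ->.
by rewrite mulrA divff ?mul1r // tofrac_eq0.
Qed.

End Operators.

(** * The weight [W a b] in terms of two Gaussian functionals *)

Section ExampleWeight.
Local Open Scope complex_scope.
Variable R : realType.
Local Notation C := R[i].

Lemma gauss_has_moments (c : R) :
  has_moments setT (fun x : R => (expR (- x ^+ 2 + c * x))%:C).
Proof.
move=> k; rewrite (_ : (fun x : R => _) = (fun x => (gauss_monomial c k x)%:C)).
  split; first exact: integrable_gauss_moment.
  exact: (integrable0 _ _).
by apply/funext => x; rewrite -rmorphM.
Qed.

Definition gauss_form (c : R) : {scalar {poly C}} :=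
  polymom_form measurableT (gauss_has_moments c).

Lemma gauss_formX c k : gauss_form c 'X^k = (gauss_moment c k)%:C.
Proof.
rewrite /= /polymom (_ : (fun x : R => _) = (fun x => (gauss_monomial c k x)%:C)).
  by rewrite /cintegral Rintegral_cst // mul0r.
by apply/funext => x; rewrite hornerXn -rmorphXn -rmorphM.
Qed.

(** The logarithmic derivative of the weight is [- (2 x - c)]; on monomials the identity is
    [gauss_moment_rec]. *)
Lemma gauss_pearson c : pearson (gauss_form c) (2%:R *: 'X - (c%:C)%:P).
Proof.
apply: pearson_monomials => k; rewrite derivXn mulrBl -scalerAl -exprS mul_polyC.
move: (gauss_form c) (gauss_formX c) => L LX.
rewrite raddfMn linearB !linearZ /= !LX.
have := congr1 (real_complex R) (gauss_moment_rec c k).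
rewrite !rmorphD rmorphN !rmorphM rmorph0 !rmorph_nat /= => E.
by rewrite -mulr_natl -[RHS]addr0 -E -[_ *: _]/(c%:C * _); ring.
Qed.

Section Wab.
Variables (a b : R).

Let alpha : {poly C} := a%:C *: 'X.

Lemma conj_alpha : conj_poly alpha = alpha.
Proof.
rewrite /conj_poly /alpha map_polyZ map_polyX /=; congr (_ *: _).
exact: conjc_real.
Qed.

Lemma moment_W (p : {poly C}) :
  [/\ moment (W a b) 0 0 p = gauss_form (2 * b) p + gauss_form 0 (alpha ^+ 2 * p),
      moment (W a b) 0 1 p = gauss_form 0 (alpha * p),
      moment (W a b) 1 0 p = gauss_form 0 (alpha * p)
    & moment (W a b) 1 1 p = gauss_form 0 p].
Proof.
have sE : wm_supp (W a b) = setT by exact: open_interval_setT.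
have mT := @measurableT _ (measurableTypeR R).
have Ig c p' := polymom_integrable mT p' (gauss_has_moments c).
split; rewrite /= /polymom sE.
- rewrite -[X in X + _]mul1r -cintegralDZ; [|exact: mT|exact: Ig|exact: Ig].
  apply: eq_cintegral => x _; rewrite !mxE /= hornerM horner_exp hornerZ hornerX.
  rewrite mul0r addr0 expRD !(rmorphM, rmorphD, rmorphXn) /=; ring.
- apply: eq_cintegral => x _; rewrite !mxE /= hornerM hornerZ hornerX.
  by rewrite mul0r addr0 !(rmorphM, rmorphD, rmorphXn) /=; ring.
- apply: eq_cintegral => x _; rewrite !mxE /= hornerM hornerZ hornerX.
  by rewrite mul0r addr0 !(rmorphM, rmorphD, rmorphXn) /=; ring.
- by apply: eq_cintegral => x _; rewrite !mxE /= mul0r addr0 mulr1.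
Qed.

Definition row2 (T : Type) (x y : T) : 'rV[T]_2 := \row_j if j == 0 then x else y.

Lemma row2_0 (T : Type) (x y : T) : row2 x y 0 0 = x.
Proof. by rewrite mxE. Qed.

Lemma row2_1 (T : Type) (x y : T) : row2 x y 0 1 = y.
Proof. by rewrite mxE. Qed.

(** The factorization of [W] at the level of forms: [(v 0 0, alpha * v 0 0 + v 0 1)] is [v] times
    [[[1, alpha], [0, 1]]]. *)
Lemma rowform_W (v w : 'rV[{poly C}]_2) :
  rowform (W a b) v w =
    gauss_form (2 * b) (v 0 0 * conj_poly (w 0 0))
    + gauss_form 0 ((alpha * v 0 0 + v 0 1)
                    * conj_poly (alpha * w 0 0 + w 0 1)).
Proof.
rewrite /rowform !big_ord_recl !big_ord0 !addr0.
have -> : lift ord0 (ord0 : 'I_1) = 1 :> 'I_2 by exact/val_inj.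
rewrite -![ord0]/(0 : 'I_2).
rewrite !(let: And4 h _ _ _ := moment_W _ in h, let: And4 _ h _ _ := moment_W _ in h,
  let: And4 _ _ h _ := moment_W _ in h, let: And4 _ _ _ h := moment_W _ in h).
move: (gauss_form 0) (gauss_form (2 * b)) => L0 L.
rewrite -!addrA; congr (_ + _); rewrite -!linearD /=; congr (L0 _).
rewrite conj_polyD conj_polyM conj_alpha; ring.
Qed.

(* [(1, - alpha)] and [(0, 1)] are the rows of the inverse of
   [[1, alpha], [0, 1]], so pairing with them isolates one Gaussian. *)
Lemma rowform_W_left (v : 'rV[{poly C}]_2) q :
  rowform (W a b) v (row2 q (- alpha * q)) = gauss_form (2 * b) (v 0 0 * conj_poly q).
Proof.
rewrite rowform_W row2_0 row2_1 mulNr subrr conj_poly0 mulr0.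
by rewrite (linear0 (gauss_form 0)) addr0.
Qed.

Lemma rowform_W_right (v : 'rV[{poly C}]_2) q :
  rowform (W a b) v (row2 0 q) = gauss_form 0 ((alpha * v 0 0 + v 0 1) * conj_poly q).
Proof.
rewrite rowform_W row2_0 row2_1 conj_poly0 !mulr0 add0r.
by rewrite (linear0 (gauss_form (2 * b))) add0r.
Qed.

(** Each Gaussian form is the restriction of the definite form of [W] to rows [row2 0 g] or
    [row2 g (- alpha * g)], so definiteness is inherited. *)
Lemma gauss_form_nondegenerate :
  nondegenerate (gauss_form 0) /\ nondegenerate (gauss_form (2 * b)).
Proof.
split=> g g0.
  rewrite -(row2_1 0 g) (_ : row2 0 g = 0) ?mxE //.
  apply: (@rowform_eq0 _ _ (W a b)).
  by rewrite rowform_W_right row2_0 row2_1 mulr0 add0r mulrC g0.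
rewrite -(row2_0 g (- alpha * g)) (_ : row2 _ _ = 0) ?mxE //.
apply: (@rowform_eq0 _ _ (W a b)).
by rewrite rowform_W_left row2_0 [g * _]mulrC g0.
Qed.

End Wab.
End ExampleWeight.

(** * Consequences of a Darboux transformation, and the contradiction *)

Section Main.
Local Open Scope complex_scope.
Variables (R : realType) (a b : R).
Local Notation C := R[i].
Local Notation alpha := (a%:C *: 'X : {poly C}).

(** The factor [f] moves onto [w] as its conjugate. Once [n] reaches the stated bound on sizes, the
    product has degree below [n], hence is orthogonal to the rows of [Pt n] and to their constant
    combinations. *)
Lemma darboux_orthogonal N (V : weight_matrix R N)
    (Pt : nat -> 'M[{poly C}]_N) (f : {poly C}) (c : nat -> 'M[C]_N) (Q : nat -> 'M[{poly C}]_N)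
    (w : 'rV[{poly C}]_N) :
  monic_orthogonal V Pt ->
  (forall n, Q n = f *: (map_mx polyC (c n) *m Pt n)) ->
  exists M, forall n, (M <= n)%N -> forall i, rowform V (row i (Q n)) w = 0.
Proof.
move=> oPt QE; exists (size f + \max_j size (w 0%R j))%N => n Mn i.
have w0 k : rowform V (row k (Pt n)) (conj_poly f *: w) = 0.
  apply: (rowform_row_eq0 oPt) => j; rewrite mxE.
  apply: (leq_trans (size_polyMleq _ _)).
  rewrite size_conj_poly (leq_trans (leq_pred _)) // (leq_trans _ Mn) // leq_add2l.
  exact: (leq_bigmax j).
rewrite QE.
have -> : row i (f *: (map_mx polyC (c n) *m Pt n)) =
    f *: \sum_k (c n i k)%:P *: row k (Pt n).
  apply/rowP => j; rewrite !mxE summxE; congr (_ * _).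
  by apply: eq_bigr => k _; rewrite !mxE.
rewrite rowformMl; elim/big_rec : _ => [|k x _ x0]; first exact: rowform0l.
by rewrite rowformDZl w0 x0 mulr0 addr0.
Qed.

Lemma moment_representation N (V : weight_matrix R N) P k (L : {scalar {poly C}}) h :
  direct_sum_classical V -> monic_orthogonal V P ->
  (exists M, forall n, (M <= n)%N -> L (P n k k * h) = 0) ->
  exists r, forall f, L (f * h) = moment V k k (f * r).
Proof.
move=> dV oP [M LM].
have [orth nz] := direct_sum_diag_orthogonal k dV oP.
have u_lin : linear_for *%R (fun f => L (f * h)).
  by move=> c f g; rewrite mulrDl -scalerAl linearP.
pose u : {scalar {poly C}} :=
  HB.pack (fun f => L (f * h)) (GRing.isLinear.Build C {poly C} C *%R _ u_lin).
exact: (@functional_of_kernel C u (moment V k k) (fun n => P n k k)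
  (fun n => conj_poly (P n k k)) M (fun n => diag_monic k (oP.1 n)) orth nz LM).
Qed.

Lemma darboux_row_dichotomy (V : weight_matrix R 2) P Pt D f (c : nat -> 'M[C]_2) k :
  b != 0 -> direct_sum_classical V -> monic_orthogonal V P ->
  monic_orthogonal (W a b) Pt ->
  (forall n, diffop_poly_act (P n) D = f *: (map_mx polyC (c n) *m Pt n)) ->
  forall n, let Q := diffop_poly_act (P n) D in
    Q k 0 = 0 \/ alpha * Q k 0 + Q k 1 = 0.
Proof.
move=> b0 dV oP oPt QE n /=.
have [nd0 ndb] := gauss_form_nondegenerate a b.
have Qop m l : diffop_poly_act (P m) D k l = apply_op (diffop_entry D k l) (P m k k).
  apply: diffop_poly_act_diag => j kj.
  exact: (direct_sum_orthogonal_diag m dV oP kj).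
set E0 := diffop_entry D k 0 in Qop *; set E1 := diffop_entry D k 1.
set phi : R -> {poly C} := fun c => 2%:R *: 'X - (c%:C)%:P.
(* Each Gaussian has its own Pearson polynomial, so the operator is moved onto [q] by a different
   adjoint in [h] and in [g]. *)
pose h q := op_adj (phi (2 * b)) E0 q.
pose g q := op_adj (phi 0) E0 (alpha * q) + op_adj (phi 0) E1 q.
have hP p q : gauss_form (2 * b) (apply_op E0 p * q) = gauss_form (2 * b) (p * h q).
  exact: (op_adjP _ _ _ (gauss_pearson _)).
have gE p q : gauss_form 0 ((alpha * apply_op E0 p + apply_op E1 p) * q)
    = gauss_form 0 (p * g q).
  have p0 := gauss_pearson (0 : R); move: (gauss_form 0) p0 => L0 p0.
  rewrite mulrDl -mulrA mulrCA linearD mulrDr linearD /=.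
  by rewrite !(op_adjP _ _ _ p0).
have rP q : exists r, forall u, gauss_form (2 * b) (u * h q) = moment V k k (u * r).
  apply: (moment_representation dV oP).
  have [M HM] := darboux_orthogonal (row2 (conj_poly q) (- alpha * conj_poly q)) oPt QE.
  exists M => m /HM/(_ k); rewrite rowform_W_left conj_polyK mxE Qop.
  by rewrite hP.
have sP q : exists s, forall u, gauss_form 0 (u * g q) = moment V k k (u * s).
  apply: (moment_representation dV oP).
  have [M HM] := darboux_orthogonal (row2 0 (conj_poly q)) oPt QE.
  exists M => m /HM/(_ k); rewrite rowform_W_right conj_polyK !mxE !Qop.
  by rewrite gE.
have dich q q' : h q = 0 \/ g q' = 0.
  have [r Hr] := rP q; have [s Hs] := sP q'.
  apply: (pearson_dichotomy (c := (2 * b)%:C) _ (gauss_pearson 0) _ ndb nd0 Hr Hs).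
    by rewrite fmorph_eq0 mulf_neq0 // pnatr_eq0.
  by rewrite (_ : (0 : R)%:C = 0) // polyC0 subr0; exact: gauss_pearson.
rewrite !Qop -/E1.
(* From pairs to uniform alternatives: a single [q] with [h q] nonzero forces [g q'] to vanish for
   every [q']. *)
have [h0|/existsNP[q hq]] := pselect (forall q, h q = 0).
  left; apply: ndb => q; rewrite [q * _]mulrC hP h0 mulr0.
  exact: (linear0 (gauss_form (2 * b))).
right; apply: nd0 => q'; rewrite [q' * _]mulrC gE.
have [//|->] := dich q q'; rewrite mulr0; exact: (linear0 (gauss_form 0)).
Qed.

End Main.

Theorem theorem1p2 (R : realType) (a b : R) :
  a != 0 -> b != 0 ->
  forall V : weight_matrix R 2,
    direct_sum_classical V -> ~ bispectral_darboux V (W a b).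
Proof.
move=> a0 b0 V dV [P [Pt [oP oPt [D [_ [f [ft [c [ct [_ [f0 _] [n0 cu] DE _]]]]]]]]]].
have QE n : diffop_poly_act (P n) D = f *: (map_mx polyC (c n) *m Pt n).
  exact: darboux_poly f0 (DE n).
have [c_unit _] := cu n0 (leqnn _).
pose A := map_mx polyC (c n0) *m Pt n0.
(* Since [Pt n0] is monic, [A] has degree at most [n0] with coefficient matrix [c n0] in that
   degree. *)
have A_high k l m : (n0 <= m)%N -> (A k l)`_m = if m == n0 then c n0 k l else 0.
  move=> nm; rewrite mxE coef_sum (bigD1 l) //= big1 => [|j jl].
    rewrite addr0 mxE coefCM.
    have /leq_sizeP/(_ m nm) := diag_monic l (oPt.1 n0).
    rewrite coefB coefXn => /eqP; rewrite subr_eq0 => /eqP ->.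
    by case: eqP; rewrite ?mulr1 ?mulr0.
  rewrite mxE coefCM; have /leq_sizeP/(_ m nm) := oPt.1 n0 j l.
  by rewrite !mxE (negbTE jl) mulr0n subr0 => ->; rewrite mulr0.
have c0 k : c n0 k 0 = 0.
  have := darboux_row_dichotomy k b0 dV oP oPt QE n0; rewrite /= QE -/A.
  have fA l : (f *: A) k l = f * A k l by rewrite mxE.
  rewrite !fA.
  move=> [/eqP|].
    rewrite mulf_eq0 (negbTE f0) => /eqP A0.
    by have := A_high k 0 n0 (leqnn _); rewrite eqxx A0 coef0.
  rewrite mulrCA -mulrDr => /eqP; rewrite mulf_eq0 (negbTE f0) => /eqP A0.
  (* In degree [n0.+1] the entry [A k 1] contributes nothing, while [alpha * A k 0] contributes
     [a * c n0 k 0]; as [a] is nonzero, the entry vanishes. *)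
  have := A_high k 1 n0.+1 (leqnSn _); rewrite gtn_eqF //.
  have := A_high k 0 n0 (leqnn _); rewrite eqxx => <-.
  move: A0 => /(congr1 (fun p : {poly _} => p`_n0.+1)).
  rewrite coefD -scalerAl coefZ coefXM /= coef0 => A0 A1; move/eqP: A0.
  by rewrite A1 addr0 mulf_eq0 fmorph_eq0 (negbTE a0) => /eqP.
move: c_unit; rewrite unitmxE (expand_det_col _ 0) big1 ?unitr0 // => k _.
by rewrite c0 mul0r.
Qed.
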